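(* Let $A$ be a $C^*$-algebra and let $V$ be a Hilbert $A$-module. Let $LM(V)=\mathrm{Hom}_A(A,V)$, let $LM(A)=\mathrm{End}_A(A)$, and let $\Gamma:V\to LM(V)$ be given by $(\Gamma(x))(a)=xa$ for $x\in V$, $a\in A$. Then the strictly essential Banach extension $(LM(V),LM(A),\Gamma)$ of $V$ is maximal.
   Context: Hilbert $A$-modules are right modules, with norm $\|x\|=\|\langle x,x\rangle\|^{1/2}$. For right Banach $A$-modules $V_1,V_2$ (in particular Hilbert $A$-modules), $\mathrm{Hom}_A(V_1,V_2)$ is the set of all bounded $A$-linear operators $V_1\to V_2$ with the operator norm, and $\mathrm{End}_A(V)=\mathrm{Hom}_A(V,V)$. The $C^*$-algebra $A$ is viewed as a right Hilbert module over itself with $\langle a,b\rangle=a^*b$. $LM(A)=\mathrm{End}_A(A)$ is a Banach algebra under composition, and $A$ is regarded as a subalgebra of $LM(A)$ by letting $a\in A$ act as left multiplication $b\mapsto ab$. $LM(V)$ is a right $LM(A)$-module via $(yb)(a)=y(b(a))$ for $y\in LM(V)$, $b\in LM(A)$, $a\in A$. If $\mathcal{B}$ is a Banach algebra and $A\subset\mathcal{B}$ (possibly via an embedding of an isomorphic copy) is a $C^*$-subalgebra which is a left ideal of $\mathcal{B}$ (i.e. $\mathcal{B}A\subset A$), then $A$ is a left strictly essential ideal of $\mathcal{B}$ if $\|b\|=\sup\{\|ba\|: a\in A,\|a\|\le 1\}$ for all $b\in\mathcal{B}$. A Banach extension of a Hilbert $A$-module $V$ is a triple $(W,\mathcal{B},\Phi)$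 where: (1) $\mathcal{B}$ is a Banach algebra and $A\subset\mathcal{B}$ is a $C^*$-subalgebra that is a left ideal; (2) $W$ is a (right) Banach $\mathcal{B}$-module; (3) $\Phi:V\to W$ is an $A$-linear isometric map; (4) $\mathrm{Im}\,\Phi=WA$, where $WA$ is the closed linear span of $\{ya: y\in W,a\in A\}$. It is strictly essential if $A\subset\mathcal{B}$ is a left strictly essential ideal and $\|y\|=\sup\{\|ya\|: a\in A,\|a\|\le 1\}$ for all $y\in W$. A strictly essential Banach extension $(\widehat W,\widehat{\mathcal{B}},\widehat\Phi)$ of $V$ is maximal if for any other strictly essential Banach extension $(W,\mathcal{B},\Phi)$ of $V$ there are an isometric homomorphism $\lambda:\mathcal{B}\to\widehat{\mathcal{B}}$ which is the identity on (the copies of) $A$ and an isometric linear map $\Lambda:W\to\widehat W$ such that $\Lambda(yb)=\Lambda(y)\lambda(b)$ for all $y\in W$, $b\in\mathcal{B}$, and $\Lambda\circ\Phi=\widehat\Phi$. *)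

(* Defs.v *)
From HB Require Import structures.
From mathcomp Require Import all_boot all_order all_algebra.
From mathcomp Require Import complex.
From mathcomp Require Import all_classical all_reals all_analysis.

Set Implicit Arguments.
Unset Strict Implicit.
Unset Printing Implicit Defensive.

Import Order.TTheory GRing.Theory Num.Theory.
Import numFieldNormedType.Exports.

Local Open Scope classical_set_scope.
Local Open Scope complex_scope.
Local Open Scope ring_scope.

(* In a normed space over R[i] the library norm takes its values in R[i];
   nrm is the same norm with values in R, where suprema are available. *)
Definition nrm (R : realType) (V : normedModType R[i]) (x : V) : R :=
  complex.Re `|x|.

HB.mixin Record isBanachAlgebra (R : realType) B
    & CompleteNormedModule R[i] B := {
  bmul : B -> B -> B;
  bmulA : forall a b c, bmul a (bmul b c) = bmul (bmul a b) c;
  bmul_linearl : forall b, linear (fun a => bmul a b);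
  bmul_linearr : forall a, linear (bmul a);
  nrm_bmul : forall a b, nrm (bmul a b) <= nrm a * nrm b
}.

(* Banach algebras are complex and need not have a unit. *)
#[short(type="banachAlgType")]
HB.structure Definition BanachAlgebra (R : realType) :=
  { B of CompleteNormedModule R[i] B & isBanachAlgebra R B }.

Notation "a ** b" := (bmul a b) (at level 40, left associativity) : ring_scope.

HB.mixin Record isCstarAlgebra (R : realType) A & BanachAlgebra R A := {
  star : A -> A;
  starK : involutive star;
  starP : forall (c : R[i]) a b, star (c *: a + b) = c^* *: star a + star b;
  starM : forall a b, star (a ** b) = star b ** star a;
  cstar_identity : forall a, nrm (star a ** a) = nrm a ^+ 2
}.

#[short(type="cstarAlgType")]
HB.structure Definition CstarAlgebra (R : realType) :=
  { A of BanachAlgebra R A & isCstarAlgebra R A }.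

HB.mixin Record isBanachModule (R : realType) (B : banachAlgType R) W
    & CompleteNormedModule R[i] W := {
  ract : W -> B -> W;
  ractA : forall y a b, ract y (a ** b) = ract (ract y a) b;
  ract_linearl : forall b, linear (fun y => ract y b);
  ract_linearr : forall y, linear (ract y);
  nrm_ract : forall y b, nrm (ract y b) <= nrm y * nrm b
}.

(* Right Banach modules. *)
#[short(type="banachModType")]
HB.structure Definition BanachModule (R : realType) (B : banachAlgType R) :=
  { W of CompleteNormedModule R[i] W & isBanachModule R B W }.

Notation "y *> b" := (ract y b) (at level 40, left associativity) : ring_scope.

(* The bound nrm_ract is automatic for Hilbert modules, since
   |xa|^2 = |a^* <x, x> a|, so building on Banach modules is no restriction. *)
HB.mixin Record BanachModule_isHilbert (R : realType) (A : cstarAlgType R) V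
    & BanachModule R A V := {
  inner : V -> V -> A;
  inner_linear : forall x, linear (inner x);
  inner_act : forall x y a, inner x (y *> a) = inner x y ** a;
  inner_star : forall x y, star (inner x y) = inner y x;
  inner_ge0 : forall x, exists b, inner x x = star b ** b;
  nrm_inner : forall x, nrm x = Num.sqrt (nrm (inner x x))
}.

#[short(type="hilbertModType")]
HB.structure Definition HilbertModule (R : realType) (A : cstarAlgType R) :=
  { V of BanachModule R A V & BanachModule_isHilbert R A V }.

Section NormTheory.
Context {R : realType}.
Implicit Types V : normedModType R[i].

Lemma nrmE V (x : V) : `|x| = (nrm x)%:C.
Proof. by rewrite /nrm RRe_real// normr_real. Qed.

Lemma nrm_ge0 V (x : V) : 0 <= nrm x.
Proof. by rewrite -lecR -nrmE normr_ge0. Qed.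

Lemma nrmD V (x y : V) : nrm (x + y) <= nrm x + nrm y.
Proof. by rewrite -lecR rmorphD/= -!nrmE ler_normD. Qed.

Lemma nrmN V (x : V) : nrm (- x) = nrm x.
Proof. by rewrite /nrm normrN. Qed.

Lemma nrmB V (x y : V) : nrm (x - y) = nrm (y - x).
Proof. by rewrite -nrmN opprB. Qed.

Lemma nrm0 V : nrm (0 : V) = 0.
Proof. by rewrite /nrm normr0. Qed.

Lemma nrm0_eq0 V (x : V) : nrm x = 0 -> x = 0.
Proof. by move=> x0; apply/normr0_eq0; rewrite nrmE x0. Qed.

Lemma nrmZ V (c : R[i]) (x : V) : nrm (c *: x) = complex.Re `|c| * nrm x.
Proof.
by apply/complexI; rewrite rmorphM/= -!nrmE normrZ.
Qed.

Lemma ltr_nrm V (x : V) (e : R) : (`|x| < e%:C) = (nrm x < e).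
Proof. by rewrite nrmE ltcR. Qed.

End NormTheory.

Section ActTheory.
Context {R : realType} {B : banachAlgType R} {W : banachModType B}.
Implicit Types (y z : W) (a b : B).

Lemma ractDl y z b : (y + z) *> b = y *> b + z *> b.
Proof. by have := ract_linearl b 1 y z; rewrite !scale1r. Qed.

Lemma ractZl (c : R[i]) y b : (c *: y) *> b = c *: (y *> b).
Proof.
have act0 : 0 *> b = 0 :> W by apply: (addrI (0 *> b)); rewrite -ractDl !addr0.
by have := ract_linearl b c y 0; rewrite !addr0 act0 addr0.
Qed.

Lemma ractBl y z b : (y - z) *> b = y *> b - z *> b.
Proof. by rewrite ractDl -scaleN1r ractZl scaleN1r. Qed.

End ActTheory.

(* A as a right module over itself. *)
Definition regular_module (R : realType) (A : banachAlgType R) : Type := A.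

Section RegularModule.
Context {R : realType}.

HB.instance Definition _ (A : banachAlgType R) :=
  CompleteNormedModule.on (regular_module A).
HB.instance Definition _ (A : banachAlgType R) :=
  isBanachModule.Build R A (regular_module A)
    (@bmulA R A) (@bmul_linearl R A) (@bmul_linearr R A) (@nrm_bmul R A).

Context (A : cstarAlgType R).

Let reg_inner (a b : regular_module A) : A := star (a : A) ** b.

Let reg_inner_linear a : linear (reg_inner a).
Proof. exact: bmul_linearr. Qed.

Let reg_inner_act (a b : regular_module A) (c : A) :
  reg_inner a (b *> c) = reg_inner a b ** c.
Proof. exact: bmulA. Qed.

Let reg_inner_star a b : star (reg_inner a b) = reg_inner b a.
Proof. by rewrite /reg_inner starM starK. Qed.

Let reg_inner_ge0 a : exists b, reg_inner a a = star b ** b.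
Proof. by exists a. Qed.

Let reg_nrm_inner (a : regular_module A) :
  nrm a = Num.sqrt (nrm (reg_inner a a)).
Proof. by rewrite cstar_identity sqrtr_sqr ger0_norm ?nrm_ge0. Qed.

HB.instance Definition _ :=
  BanachModule_isHilbert.Build R A (regular_module A)
    reg_inner_linear reg_inner_act reg_inner_star reg_inner_ge0 reg_nrm_inner.

End RegularModule.

Section Homs.
Context {R : realType} {B : banachAlgType R}.

Section HomType.
Variables V1 V2 : banachModType B.

Definition is_bounded_module_map (f : V1 -> V2) : Prop :=
  [/\ linear f, forall x b, f (x *> b) = f x *> b &
      exists M : R, forall x, nrm (f x) <= M * nrm x].

Definition hom_pred : {pred V1 -> V2} :=
  [pred f | `[< is_bounded_module_map f >]].

Record ModHom := MkModHom { hom_fun :> V1 -> V2; hom_in : hom_fun \in hom_pred }.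

HB.instance Definition _ := [isSub for hom_fun].
HB.instance Definition _ := [Choice of ModHom by <:].

Lemma homP (f : ModHom) : is_bounded_module_map f.
Proof. by case: f => f fP; apply/asboolP. Qed.

Definition mk_hom (f : V1 -> V2) (fP : is_bounded_module_map f) : ModHom :=
  @MkModHom f (asboolT fP).

Lemma hom_ext (f g : ModHom) : (forall x, f x = g x) -> f = g.
Proof. by move=> fg; apply/val_inj/funext. Qed.

Lemma hom_submod_closed : submod_closed hom_pred.
Proof.
split.
  apply/asboolP; split=> [c x y|x b|] /=; rewrite ?fctE.
  - by rewrite scaler0 addr0.
  - by rewrite -(scale0r 0) ractZl !scale0r.
  - by exists 0 => x; rewrite nrm0 mul0r.
move=> c f g /asboolP[fl fA [M fM]] /asboolP[gl gA [N gN]].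
apply/asboolP; split=> [d x y|x b|] /=.
- rewrite !fctE fl gl !scalerDr !scalerA [c * d]mulrC.
  by rewrite -!addrA; congr (_ + _); rewrite addrCA.
- by rewrite !fctE fA gA ractDl ractZl.
- exists (complex.Re `|c| * M + N) => x; rewrite mulrDl (le_trans (nrmD _ _))//.
  rewrite lerD ?gN// nrmZ -mulrA ler_wpM2l//.
  by have := nrm_ge0 (c : R[i]^o).
Qed.

HB.instance Definition _ :=
  GRing.isSubmodClosed.Build _ _ hom_pred hom_submod_closed.
HB.instance Definition _ := [SubChoice_isSubLmodule of ModHom by <:].

Definition op_norm (f : ModHom) : R :=
  sup [set nrm (f x) | x in [set x | nrm x <= 1]].

Lemma homD (f : ModHom) x y : f (x + y) = f x + f y.
Proof. by have [fl _ _] := homP f; have := fl 1 x y; rewrite !scale1r. Qed.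

Lemma hom0 (f : ModHom) : f 0 = 0.
Proof. by apply: (addrI (f 0)); rewrite -homD !addr0. Qed.

Lemma homZ (f : ModHom) (c : R[i]) x : f (c *: x) = c *: f x.
Proof.
by have [fl _ _] := homP f; have := fl c x 0; rewrite hom0 !addr0.
Qed.

Lemma homA (f : ModHom) x b : f (x *> b) = f x *> b.
Proof. by case: (homP f). Qed.

Lemma has_sup_op_norm (f : ModHom) :
  has_sup [set nrm (f x) | x in [set x | nrm x <= 1]].
Proof.
split; first by exists (nrm (f 0)), 0 => //=; rewrite nrm0.
have [_ _ [M fM]] := homP f.
exists `|M| => _ [x /= x1 <-]; rewrite (le_trans (fM x))//.
rewrite (le_trans (ler_wpM2r (nrm_ge0 _) (ler_norm M)))//.
by rewrite ler_piMr.
Qed.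

Lemma op_norm_le1 (f : ModHom) x : nrm x <= 1 -> nrm (f x) <= op_norm f.
Proof. by move=> x1; apply: ub_le_sup; [case: (has_sup_op_norm f)|exists x]. Qed.

Lemma op_norm_ge0 (f : ModHom) : 0 <= op_norm f.
Proof. by rewrite (le_trans (nrm_ge0 (f 0)))// op_norm_le1// nrm0. Qed.

Lemma nrm_hom (f : ModHom) x : nrm (f x) <= op_norm f * nrm x.
Proof.
have [x0|x0] := eqVneq (nrm x) 0.
  by rewrite (nrm0_eq0 x0) hom0 !nrm0 mulr0.
have xp : 0 < nrm x by rewrite lt_neqAle eq_sym x0 nrm_ge0.
have ReV : complex.Re `|((nrm x)^-1)%:C| = (nrm x)^-1.
  by rewrite ger0_norm// lecR invr_ge0 nrm_ge0.
have := @op_norm_le1 f (((nrm x)^-1)%:C *: x).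
rewrite homZ !nrmZ ReV mulVf// => /(_ (lexx _)).
by rewrite ler_pdivrMl// mulrC.
Qed.

Lemma op_norm_le (f : ModHom) (M : R) : 0 <= M ->
  (forall x, nrm (f x) <= M * nrm x) -> op_norm f <= M.
Proof.
move=> M0 fM; apply: ge_sup; first by case: (has_sup_op_norm f).
by move=> _ [x /= x1 <-]; rewrite (le_trans (fM x))// ler_piMr.
Qed.

Definition hom_norm (f : ModHom) : R[i] := (op_norm f)%:C.

Let hom_normD f g : hom_norm (f + g) <= hom_norm f + hom_norm g.
Proof.
rewrite /hom_norm -rmorphD lecR op_norm_le ?addr_ge0 ?op_norm_ge0// => x.
by rewrite (le_trans (nrmD _ _))// mulrDl lerD ?nrm_hom.
Qed.

Let hom_norm0_eq0 f : hom_norm f = 0 -> f = 0.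
Proof.
move=> /complexI f0; apply: hom_ext => x; apply: nrm0_eq0; apply/eqP.
by rewrite eq_le nrm_ge0 andbT; have := nrm_hom f x; rewrite f0 mul0r.
Qed.

Let op_normZ_le (c : R[i]) f : op_norm (c *: f) <= complex.Re `|c| * op_norm f.
Proof.
have c0 : 0 <= complex.Re `|c| := nrm_ge0 (c : R[i]^o).
rewrite op_norm_le ?mulr_ge0 ?op_norm_ge0// => x.
by rewrite -[X in nrm X]/(c *: f x) nrmZ -mulrA ler_wpM2l// nrm_hom.
Qed.

Let hom_normZ (c : R[i]) f : hom_norm (c *: f) = `|c| * hom_norm f.
Proof.
have REc (d : R[i]) : (complex.Re `|d|)%:C = `|d|.
  by rewrite RRe_real// normr_real.
have [->|c0] := eqVneq c 0.
  rewrite scale0r normr0 mul0r; congr (_%:C); apply/eqP.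
  rewrite eq_le op_norm_ge0 andbT op_norm_le// => x.
  by rewrite nrm0 mul0r.
rewrite /hom_norm -[in RHS]REc -rmorphM; congr (_%:C).
apply/eqP; rewrite eq_le op_normZ_le/=.
have := op_normZ_le c^-1 (c *: f); rewrite scalerA mulVf// scale1r.
have cp : 0 < complex.Re `|c| by rewrite -ltcR REc normr_gt0.
rewrite -(ler_pM2l cp) mulrA.
suff -> : complex.Re `|c| * complex.Re `|c^-1| = 1 by rewrite mul1r.
by apply/complexI; rewrite rmorphM/= !REc -normrM mulfV// normr1.
Qed.

HB.instance Definition _ :=
  Lmodule_isNormed.Build R[i] ModHom hom_normD hom_normZ hom_norm0_eq0.

Lemma nrm_homE (f : ModHom) : nrm f = op_norm f.
Proof. by []. Qed.

End HomType.
End Homs.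

Section HomComplete.
Context {R : realType} {B : banachAlgType R} (V1 V2 : banachModType B).
Local Notation H := (ModHom V1 V2).

Let pos_complex (e : R[i]) : 0 < e -> exists2 r : R, 0 < r & e = r%:C.
Proof.
move=> e0; have er : (complex.Re e)%:C = e by rewrite RRe_real// gtr0_real.
by exists (complex.Re e) => //; rewrite -ltcR er.
Qed.

Let small_eq0 (V : normedModType R[i]) (u : V) (M : R) : 0 <= M ->
  (forall e : R, 0 < e -> nrm u <= e * M) -> u = 0.
Proof.
move=> M0 uM; apply: nrm0_eq0; apply/eqP; rewrite eq_le nrm_ge0 andbT.
apply/ler_addgt0Pr => e e0; rewrite add0r.
have M1 : 0 < M + 1 by rewrite ltr_wpDl.
apply: le_trans (uM (e / (M + 1)) _) _; first by rewrite divr_gt0.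
by rewrite mulrAC ler_pdivrMr// ler_pM2l// lerDl.
Qed.

Let approx (F : set_system H) : ProperFilter F -> cauchy F ->
  exists g : V1 -> V2, forall e : R, 0 < e -> exists f : H,
    F (ball f e%:C) /\ forall x, nrm (g x - f x) <= e * nrm x.
Proof.
move=> FF Fc; have Fex : cauchy_ex F by apply/cauchyP.
pose ev (x : V1) (f : H) : V2 := f x.
have evc x : cvg (ev x @ F).
  apply: cauchy_cvg; apply: cauchy_exP => e /pos_complex[r r0 ->].
  have x1 : 0 < nrm x + 1 by rewrite ltr_wpDl ?nrm_ge0.
  have [|f Ff] := Fex (r / (nrm x + 1))%:C; first by rewrite ltcR divr_gt0.
  exists (ev x f); rewrite /nbhs/=; apply: filterS Ff => h.
  rewrite -!ball_normE/= !ltr_nrm => fh.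
  rewrite -[ev x f - ev x h]/((f - h : H) x) (le_lt_trans (nrm_hom _ _))//.
  rewrite (le_lt_trans (ler_wpM2r (nrm_ge0 x) (ltW fh)))//.
  by rewrite mulrAC ltr_pdivrMr// ltr_pM2l// ltrDl.
exists (fun x => lim (ev x @ F)) => e e0.
have [|f Ff] := Fex e%:C; first by rewrite ltcR.
exists f; split=> // x; apply/ler_addgt0Pr => d d0.
have /cvgrPdist_lt/(_ d%:C) := evc x; rewrite ltcR => /(_ d0) evd.
have [h [/= + fh]] := filter_ex (filterI evd Ff).
rewrite ltr_nrm => /ltW hd.
have -> : lim (ev x @ F) - f x = (lim (ev x @ F) - ev x h) + (h - f : H) x.
  by rewrite -[(h - f : H) x]/(h x - f x) addrA subrK.
rewrite (le_trans (nrmD _ _))// addrC lerD// (le_trans (nrm_hom _ _))//.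
rewrite ler_wpM2r ?nrm_ge0//; move: fh; rewrite -ball_normE/= ltr_nrm.
by rewrite nrmB => /ltW.
Qed.

Let hom_complete (F : set_system H) : ProperFilter F -> cauchy F -> cvg F.
Proof.
move=> FF Fc; have [g gP] := approx FF Fc.
have gl : linear g.
  move=> c x y; apply/eqP; rewrite -subr_eq0; apply/eqP.
  pose M := nrm (c *: x + y) + complex.Re `|c| * nrm x + nrm y.
  have c0 : 0 <= complex.Re `|c| := nrm_ge0 (c : R[i]^o).
  apply: (@small_eq0 _ _ M) => [|e e0].
    by rewrite !addr_ge0 ?mulr_ge0 ?nrm_ge0.
  have [f [_ fg]] := gP e e0.
  have -> : g (c *: x + y) - (c *: g x + g y) =
      (g (c *: x + y) - f (c *: x + y)) + (- (c *: (g x - f x)) - (g y - f y)).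
    by rewrite homD homZ scalerBr !opprB
      [X in _ = _ + X]addrACA -opprD addrA subrK.
  rewrite /M !mulrDr -[leRHS]addrA (le_trans (nrmD _ _))// lerD ?fg//.
  rewrite (le_trans (nrmD _ _))// !nrmN lerD ?fg// nrmZ mulrCA.
  by rewrite ler_wpM2l ?fg.
have gA x b : g (x *> b) = g x *> b.
  apply/eqP; rewrite -subr_eq0; apply/eqP.
  apply: (@small_eq0 _ _ (nrm (x *> b) + nrm x * nrm b)) => [|e e0].
    by rewrite addr_ge0 ?mulr_ge0 ?nrm_ge0.
  have [f [_ fg]] := gP e e0.
  have -> : g (x *> b) - g x *> b =
      (g (x *> b) - f (x *> b)) - (g x - f x) *> b.
    by rewrite homA ractBl opprB addrA subrK.
  rewrite mulrDr (le_trans (nrmD _ _))// nrmN lerD ?fg//.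
  by rewrite (le_trans (nrm_ract _ _))// mulrA ler_wpM2r ?nrm_ge0 ?fg.
have gb : exists M : R, forall x, nrm (g x) <= M * nrm x.
  have [f [_ fg]] := gP 1 ltr01.
  exists (1 + op_norm f) => x; rewrite -[g x](subrK (f x)) mulrDl.
  by rewrite (le_trans (nrmD _ _))// lerD ?fg ?nrm_hom.
pose G : H := mk_hom (And3 gl gA gb).
apply/cvg_ex; exists G; apply/cvgrPdist_lt => e /pos_complex[r r0 ->].
have r2 : 0 < r / 2 by rewrite divr_gt0.
have [f [Ff fg]] := gP _ r2; near=> h.
rewrite ltr_nrm -[G - h](subrKA f) (le_lt_trans (nrmD _ _))//.
rewrite [ltRHS]splitr ler_ltD//.
  by rewrite nrm_homE op_norm_le// ltW.
by rewrite -ltr_nrm; near: h; apply: filterS Ff => h; rewrite -ball_normE.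
Unshelve. all: by end_near. Qed.

HB.instance Definition _ := Uniform_isComplete.Build H hom_complete.

End HomComplete.

Section HomAlgebra.
Context {R : realType} {B : banachAlgType R}.

Section Composition.
Variables V1 V2 V3 : banachModType B.

Lemma comp_is_bounded_module_map (f : ModHom V2 V3) (g : ModHom V1 V2) :
  is_bounded_module_map (f \o g).
Proof.
split=> [c x y|x b|] /=; first by rewrite homD homZ homD homZ.
  by rewrite !homA.
exists (op_norm f * op_norm g) => x; rewrite (le_trans (nrm_hom _ _))//.
by rewrite -mulrA ler_wpM2l ?op_norm_ge0 ?nrm_hom.
Qed.

Definition hom_comp (f : ModHom V2 V3) (g : ModHom V1 V2) : ModHom V1 V3 :=
  mk_hom (comp_is_bounded_module_map f g).

Lemma hom_comp_linearl g : linear (fun f => hom_comp f g).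
Proof. by move=> c f1 f2; apply: hom_ext. Qed.

Lemma hom_comp_linearr f : linear (hom_comp f).
Proof.
move=> c g1 g2; apply: hom_ext => x.
rewrite -[LHS]/(f (c *: g1 x + g2 x)) homD homZ.
by [].
Qed.

Lemma nrm_hom_comp f g : nrm (hom_comp f g) <= nrm f * nrm g.
Proof.
rewrite !nrm_homE op_norm_le ?mulr_ge0 ?op_norm_ge0// => x.
rewrite (le_trans (nrm_hom f _))//.
by rewrite -mulrA ler_wpM2l ?op_norm_ge0 ?nrm_hom.
Qed.

End Composition.

Lemma hom_compA (V1 V2 V3 V4 : banachModType B)
    (f : ModHom V3 V4) (g : ModHom V2 V3) (h : ModHom V1 V2) :
  hom_comp f (hom_comp g h) = hom_comp (hom_comp f g) h.
Proof. by apply: hom_ext. Qed.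

(* End_A(V), a Banach algebra under composition. *)
HB.instance Definition _ (V : banachModType B) :=
  isBanachAlgebra.Build R (ModHom V V)
    (@hom_compA V V V V) (@hom_comp_linearl V V V) (@hom_comp_linearr V V V)
    (@nrm_hom_comp V V V).

(* Hom_A(V1, V2), a right module over End_A(V1): (y b)(x) = y (b x). *)
HB.instance Definition _ (V1 V2 : banachModType B) :=
  isBanachModule.Build R (ModHom V1 V1) (ModHom V1 V2)
    (fun y a b => @hom_compA V1 V1 V1 V2 y a b)
    (@hom_comp_linearl V1 V1 V2) (@hom_comp_linearr V1 V1 V2)
    (@nrm_hom_comp V1 V1 V2).

End HomAlgebra.

Section Multipliers.
Context {R : realType} {A : banachAlgType R}.

Lemma Gamma_is_bounded_module_map (V : banachModType A) (x : V) :
  is_bounded_module_map (fun a : regular_module A => x *> (a : A)).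
Proof.
split=> [|a b|]; [exact: ract_linearr|exact: ractA|].
by exists (nrm x) => a; exact: nrm_ract.
Qed.

Definition Gamma (V : banachModType A) (x : V) : ModHom (regular_module A) V :=
  mk_hom (Gamma_is_bounded_module_map x).

(* The canonical map of A into LM(A), a |-> (b |-> ab), is the case V = A. *)
Definition left_mult (a : A) : ModHom (regular_module A) (regular_module A) :=
  Gamma (a : regular_module A).

End Multipliers.

Notation LM V := (ModHom (regular_module _) V).

Definition closed_span (R : realType) (W : normedModType R[i]) (S : set W) :
    set W :=
  closure [set z | exists (n : nat) (c : 'I_n -> R[i]) (v : 'I_n -> W),
    (forall i, S (v i)) /\ z = \sum_(i < n) c i *: v i].

Section Extensions.
Context {R : realType} {A : cstarAlgType R}.

(* The embedding iota of A as a C*-subalgebra of B: B carries no involution, so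
   this is an isometric isomorphism onto a (necessarily closed) subalgebra. *)
Definition is_left_ideal_embedding (B : banachAlgType R) (iota : A -> B) :
    Prop :=
  [/\ linear iota, {morph iota : a b / a ** b}, forall a, nrm (iota a) = nrm a &
      forall b a, range iota (b ** iota a)].

Definition left_strictly_essential (B : banachAlgType R) (iota : A -> B) :
    Prop :=
  forall b, nrm b = sup [set nrm (b ** iota a) | a in [set a | nrm a <= 1]].

Context (V : hilbertModType A).

(* The data (W, B, Phi) of an extension, with the embedding of A into B. *)
Record extension := Extension {
  ext_alg : banachAlgType R;
  ext_emb : A -> ext_alg;
  ext_mod : banachModType ext_alg;
  ext_map : V -> ext_mod
}.

Definition is_banach_extension (E : extension) : Prop :=
  [/\ is_left_ideal_embedding (@ext_emb E),
      linear (@ext_map E) /\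
        (forall x a, ext_map E (x *> a) = ext_map E x *> ext_emb E a),
      forall x, nrm (ext_map E x) = nrm x &
      range (ext_map E) =
        closed_span
          [set z | exists (y : ext_mod E) (a : A), z = y *> ext_emb E a]].

Definition is_strictly_essential (E : extension) : Prop :=
  [/\ is_banach_extension E, left_strictly_essential (@ext_emb E) &
      forall y : ext_mod E,
        nrm y =
          sup [set nrm (y *> ext_emb E a) | a in [set a : A | nrm a <= 1]]].

Definition is_maximal_extension (Ehat : extension) : Prop :=
  is_strictly_essential Ehat /\
  forall E : extension, is_strictly_essential E ->
  exists (lambda : ext_alg E -> ext_alg Ehat)
         (Lambda : ext_mod E -> ext_mod Ehat),
    [/\ [/\ linear lambda, {morph lambda : b c / b ** c},
            forall b, nrm (lambda b) = nrm b &
            forall a, lambda (ext_emb E a) = ext_emb Ehat a],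
        linear Lambda,
        forall y, nrm (Lambda y) = nrm y,
        forall y b, Lambda (y *> b) = Lambda y *> lambda b &
        forall x, Lambda (ext_map E x) = ext_map Ehat x].

Definition LM_extension : extension :=
  @Extension (LM (regular_module A)) left_mult (LM V) (@Gamma R A V).

End Extensions.

(* Main.v *)
From HB Require Import structures.
Require Import Defs.
From mathcomp Require Import all_boot all_order all_algebra.
From mathcomp Require Import complex.
From mathcomp Require Import all_classical all_reals all_analysis.
From mathcomp Require Import ring.

Set Implicit Arguments.
Unset Strict Implicit.
Unset Printing Implicit Defensive.

Import Order.TTheory GRing.Theory Num.Theory.
Import numFieldNormedType.Exports.

Local Open Scope classical_set_scope.
Local Open Scope complex_scope.
Local Open Scope ring_scope.

(** Write h = <x, x> for x in V.

    Maximality is formal once LM(V) is known to be an extension.  Given a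
    strictly essential extension (W, B, Phi), every product y a with y in W and
    a in A lies in W A, the range of the injective map Phi, so a |-> y a pulls
    back along Phi to an A-linear map Lambda(y) : A -> V.  Strict essentiality
    says exactly that y and Lambda(y) have the same norm.  The homomorphism
    lambda is the same construction applied to the embedding iota : A -> B, with
    the left ideal property of A confining the products; hence one lemma,
    [multiplier_representation], yields both, and all the identities required of
    lambda and Lambda hold because they hold after applying iota or Phi.

    That (LM(V), LM(A), Gamma) is itself strictly essential rests on two facts
    about V, applied also to V = A.

    - Gamma is isometric ([nrm_Gamma]): testing Gamma(x) on h gives
      |x h|^2 = |h^3|, and |h^3| is |h|^3 by the C*-identity alone.  Since
      y o left_mult(a) = Gamma(y(a)), this also gives strict essentiality.

    - V A is dense in V ([ract_dense]).  This is usually read off an approximate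
      unit, hence off the functional calculus.  The argument here is an explicit
      form of the mean ergodic theorem for a perturbation of the identity.  For
      real t the factor 1 + ith is almost unitary: right multiplication by it
      has norm at most 1 + t^2 |h|^2, because (1 + ith)(1 - ith) = 1 + t^2 h^2.
      Its first n = m^2 powers, for t = 1/m, are then bounded independently of m
      by a constant C, and if 1 + u denotes their average, then right
      multiplication by (1 + u) ith = ((1 + ith)^n - 1) / n has norm O(1/n), so
      that multiplication by (1 + u) h has norm O(1/m).  The C*-identity
      turns this into a bound on
      <x + x u, x + x u> = (1 + u)^* h (1 + u), which therefore tends to 0
      ([selfadjoint_compress_small]): x is close to - x u. *)

(** * Norms and isometries *)

Section NormLemmas.
Context {R : realType}.

Lemma nrmZr (V : normedModType R[i]) (r : R) (x : V) : 0 <= r ->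
  nrm (r%:C *: x) = r * nrm x.
Proof. by move=> r0; rewrite nrmZ ger0_norm ?lecR. Qed.

Lemma nrm_sum (V : normedModType R[i]) (I : Type) (s : seq I) (F : I -> V) :
  nrm (\sum_(i <- s) F i) <= \sum_(i <- s) nrm (F i).
Proof.
elim/big_ind2: _ => [|x r y t xr yt|//]; first by rewrite nrm0.
by rewrite (le_trans (nrmD _ _))// lerD.
Qed.

Lemma linear_isometry_inj (U W : normedModType R[i]) (f : U -> W) :
  linear f -> (forall x, nrm (f x) = nrm x) -> injective f.
Proof.
move=> fl fi x y xy; apply/eqP; rewrite -subr_eq0; apply/eqP/nrm0_eq0.
by rewrite -fi (GRing.zmod_morphism_linear fl) xy subrr nrm0.
Qed.

(** The preimages of the balls around a point of the closure form a Cauchy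
    filter on U, and its limit is sent to that point. *)
Lemma closure_range_isometry (U W : completeNormedModType R[i]) (f : U -> W) :
  linear f -> (forall x, nrm (f x) = nrm x) -> closure (range f) `<=` range f.
Proof.
move=> fl fi p pf.
have fB := GRing.zmod_morphism_linear fl.
pose S (e : R) := [set x | nrm (p - f x) < e].
have S_ex e : 0 < e -> S e !=set0.
  move=> e0; have [|_ [[x _ <-] xp]] := pf (ball p e%:C).
    by apply: nbhsx_ballx; rewrite ltcR.
  by exists x; move: xp; rewrite -ball_normE/= ltr_nrm.
pose F : set_system U := [set X | exists2 e : R, 0 < e & S e `<=` X].
have FF : ProperFilter F.
  split; first by move=> [e /S_ex[x Sx] /(_ _ Sx)].
  split; first by exists 1.
  - move=> X Y [d d0 dX] [e e0 eY]; exists (Num.min d e).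
      by rewrite lt_min d0.
    move=> x; rewrite /S/= lt_min => /andP[xd xe].
    by split; [apply: dX|apply: eY].
  - by move=> X Y XY [e e0 eX]; exists e => //; apply: subset_trans XY.
have Fc : cauchy F.
  apply: cauchy_exP => e e0.
  have er : (complex.Re e)%:C = e by rewrite RRe_real// gtr0_real.
  have r0 : 0 < complex.Re e by rewrite -ltcR er.
  have r2 : 0 < complex.Re e / 2 by rewrite divr_gt0.
  have [x Sx] := S_ex _ r2.
  exists x; exists (complex.Re e / 2) => // y Sy.
  rewrite -ball_normE/= -er ltr_nrm -fi fB -(subrKA p).
  rewrite (le_lt_trans (nrmD _ _))// [ltRHS]splitr ltrD//.
  by rewrite nrmB.
have /cvg_ex[l Fl] : cvg F by exact: cauchy_cvg.
exists l => //; apply/eqP; rewrite -subr_eq0; apply/eqP/nrm0_eq0/eqP.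
rewrite eq_le nrm_ge0 andbT; apply/ler_addgt0Pr => e e0; rewrite add0r.
have e2 : 0 < e / 2 by rewrite divr_gt0.
have Fb : F (ball l (e / 2)%:C) by apply: Fl; apply: nbhsx_ballx; rewrite ltcR.
have FS : F (S (e / 2)) by exists (e / 2).
have [x [xl Sx]] := filter_ex (filterI Fb FS).
rewrite -(subrKA (f x)) (le_trans (nrmD _ _))// [leRHS]splitr lerD//.
  by rewrite -fB fi; move: xl; rewrite -ball_normE/= ltr_nrm => /ltW.
by rewrite nrmB ltW.
Qed.

End NormLemmas.

(** * Almost unitary multipliers 1 + c of a C*-algebra *)

Section AlgebraLemmas.
Context {R : realType} {B : banachAlgType R}.
Implicit Types a b : B.

HB.instance Definition _ a :=
  GRing.isLinear.Build R[i] B B *:%R (bmul a) (bmul_linearr a).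

Lemma bmulDl a b c : (a + b) ** c = a ** c + b ** c.
Proof. exact: (@ractDl R B (regular_module B)). Qed.

Lemma bmulZl (k : R[i]) a b : (k *: a) ** b = k *: (a ** b).
Proof. exact: (@ractZl R B (regular_module B)). Qed.

Lemma bmul0l a : 0 ** a = 0.
Proof. by rewrite -[X in X ** _](scale0r (0 : B)) bmulZl scale0r. Qed.

Lemma bmul_suml (I : Type) (s : seq I) (F : I -> B) b :
  (\sum_(i <- s) F i) ** b = \sum_(i <- s) F i ** b.
Proof.
exact: (big_morph (fun x => x ** b) (fun x y => bmulDl x y b) (bmul0l b)).
Qed.

End AlgebraLemmas.

Section Cstar.
Context {R : realType} {A : cstarAlgType R}.
Implicit Types a b c h : A.

Lemma starD a b : star (a + b) = star a + star b.
Proof. by have := starP 1 a b; rewrite !rmorph1 !scale1r. Qed.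

Lemma star0 : star (0 : A) = 0.
Proof. by apply: (addrI (star 0)); rewrite -starD !addr0. Qed.

Lemma starZ (k : R[i]) a : star (k *: a) = k^* *: star a.
Proof. by have := starP k a 0; rewrite star0 !addr0. Qed.

Lemma nrm_star a : nrm (star a) = nrm a.
Proof.
have le b : nrm b <= nrm (star b).
  have [->|b0] := eqVneq (nrm b) 0; first exact: nrm_ge0.
  have bp : 0 < nrm b by rewrite lt_neqAle eq_sym b0 nrm_ge0.
  by rewrite -(ler_pM2r bp) -expr2 -cstar_identity nrm_bmul.
by apply/eqP; rewrite eq_le le -{2}(starK a) le.
Qed.

Lemma cstar_identityr a : nrm (a ** star a) = nrm a ^+ 2.
Proof. by rewrite -[X in X ** _]starK cstar_identity nrm_star. Qed.

(** (a + ac)(a + ac)^* = aa^* - a c^2 a^*, as the cross terms cancel for skew c;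
    the second term has norm at most |c|^2 |a|^2.  This gives the factor
    (1 + |c|^2)^(1/2), and 1 + |c|^2 dominates it. *)
Lemma nrm_mul1D_skew c a : star c = - c ->
  nrm (a + a ** c) <= (1 + nrm c ^+ 2) * nrm a.
Proof.
move=> cS; rewrite -(@ler_pXn2r _ 2)// ?nnegrE ?nrm_ge0//; last first.
  by rewrite mulr_ge0 ?nrm_ge0// addr_ge0// sqr_ge0.
rewrite -[X in X <= _]cstar_identityr starD starM cS.
have -> : (a + a ** c) ** (star a + - c ** star a) =
    a ** star a - a ** (c ** (c ** star a)).
  rewrite -[- c]scaleN1r bmulZl scaleN1r !bmulDl !linearD !linearN /=.
  by rewrite -!bmulA addrA addrNK.
apply: (@le_trans _ _ ((1 + nrm c ^+ 2) * nrm a ^+ 2)).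
  rewrite (le_trans (nrmD _ _))// nrmN cstar_identityr mulrDl mul1r lerD2l.
  rewrite (le_trans (nrm_bmul _ _))// [leRHS]mulrC expr2 -mulrA.
  rewrite ler_wpM2l ?nrm_ge0// mulrC (le_trans (nrm_bmul _ _))// expr2 -mulrA.
  rewrite ler_wpM2l ?nrm_ge0// mulrC -(nrm_star a) mulrC.
  by rewrite nrm_bmul.
rewrite exprMn ler_wpM2r ?sqr_ge0// expr2 ler_peMl ?lerDl ?sqr_ge0//.
by rewrite addr_ge0// sqr_ge0.
Qed.

(** (1 + c)^k - 1, written without a unit. *)
Fixpoint pow1D c (k : nat) : A :=
  if k is k'.+1 then pow1D c k' + c + pow1D c k' ** c else 0.

Lemma mul_pow1DS c a k :
  a + a ** pow1D c k.+1 = (a + a ** pow1D c k) + (a + a ** pow1D c k) ** c.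
Proof. by rewrite /= !linearD /= bmulDl bmulA !addrA. Qed.

Lemma pow1D_comm c k : c ** pow1D c k = pow1D c k ** c.
Proof.
elim: k => [|k IHk] /=; first by rewrite linear0 bmul0l.
by rewrite !linearD !bmulDl /= bmulA IHk.
Qed.

Lemma nrm_mul_pow1D c a k : star c = - c ->
  nrm (a + a ** pow1D c k) <= (1 + nrm c ^+ 2) ^+ k * nrm a.
Proof.
move=> cS; elim: k => [|k IHk]; first by rewrite linear0 addr0 expr0 mul1r.
rewrite mul_pow1DS (le_trans (nrm_mul1D_skew _ cS))// (exprS _ k) -mulrA.
by rewrite ler_wpM2l// addr_ge0// sqr_ge0.
Qed.

(** With 1 + u the average of (1 + c)^i for i <= n, the product (1 + u) c
    telescopes to ((1 + c)^(n + 1) - 1) / (n + 1). *)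
Lemma ergodic_mean c n : star c = - c ->
  let C := (1 + nrm c ^+ 2) ^+ n.+1 in
  exists u, [/\ c ** u = u ** c, forall a, nrm (a + a ** u) <= C * nrm a &
    forall a, nrm ((a + a ** u) ** c) <= (C + 1) / n.+1%:R * nrm a].
Proof.
move=> cS C; pose k : R[i] := (n.+1%:R^-1 : R)%:C.
pose u := k *: \sum_(0 <= i < n.+1) pow1D c i.
have uE a : a + a ** u = k *: \sum_(0 <= i < n.+1) (a + a ** pow1D c i).
  rewrite big_split /= scalerDr sumr_const_nat subn0 -scaler_nat scalerA.
  have -> : k * n.+1%:R = 1 by rewrite /k fmorphV rmorph_nat mulVf// pnatr_eq0.
  by rewrite scale1r /u linearZ linear_sum.
have q1 : 1 <= 1 + nrm c ^+ 2 by rewrite lerDl sqr_ge0.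
exists u; split=> [|a|a].
- rewrite /u linearZ linear_sum /= bmulZl bmul_suml; congr (_ *: _).
  by apply: eq_bigr => i _; rewrite pow1D_comm.
- rewrite uE nrmZr// ler_pdivrMl ?ltr0n//.
  apply: le_trans (nrm_sum _ _) _.
  have -> : n.+1%:R * (C * nrm a) = \sum_(0 <= i < n.+1) C * nrm a.
    by rewrite sumr_const_nat subn0 mulr_natl.
  rewrite !big_nat; apply: ler_sum => i /andP[_ /ltnW ni].
  rewrite (le_trans (nrm_mul_pow1D _ _ cS))// ler_wpM2r ?nrm_ge0//.
  by rewrite ler_weXn2l.
- rewrite uE bmulZl nrmZr// bmul_suml.
  under eq_bigr => i _.
    have -> : (a + a ** pow1D c i) ** c =
        (a + a ** pow1D c i.+1) - (a + a ** pow1D c i).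
      by rewrite mul_pow1DS addrAC subrr add0r.
    over.
  rewrite telescope_sumr// [pow1D c 0]/= linear0 addr0 mulrAC [leRHS]mulrC.
  rewrite ler_wpM2l// mulrDl mul1r (le_trans (nrmD _ _))// nrmN lerD2r.
  exact: nrm_mul_pow1D.
Qed.

(** The expression is (1 + u)^* h (1 + u).  The element u comes from
    [ergodic_mean] for c = (i/m) h and m^2 powers.  The factor
    1/m gives |c|^2 = |h|^2 / m^2, so multiplication by each of the powers has
    norm at most (1 + |h|^2 / m^2)^(m^2) <= C = exp(|h|^2); multiplying the
    O(1/m^2) bound for (1 + u) c by m, to return from c to h, leaves O(1/m). *)
Lemma selfadjoint_compress_small h (e : R) : star h = h -> 0 < e ->
  exists u, nrm (h + h ** u + star u ** (h + h ** u)) < e.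
Proof.
move=> hS e0; pose M := nrm h; pose C := expR (M ^+ 2).
have M0 : 0 <= M := nrm_ge0 h.
have C0 : 0 < C := expR_gt0 _.
have [m mP] : exists m, C ^+ 3 * (C + 1) * M / e ^+ 2 < m.+1%:R.
  exists (Num.truncn (C ^+ 3 * (C + 1) * M / e ^+ 2)); exact: truncnS_gt.
pose s : R := m.+1%:R; have s0 : 0 < s by rewrite ltr0n.
pose c := ('i * (s^-1)%:C) *: h.
have cS : star c = - c.
  rewrite /c starZ hS rmorphM /= conjCi mulNr scaleNr conj_Creal//.
  by rewrite ger0_real// lecR invr_ge0 ltW.
have nc : nrm c = s^-1 * M.
  rewrite /c mulrC -scalerA nrmZr ?invr_ge0 ?ltW//.
  by rewrite nrmZ normCi mul1r.
have [u [uc uC uCn]] := ergodic_mean (m.+1 ^ 2).-1 cS.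
rewrite prednK ?expn_gt0// in uC uCn.
set C' := _ ^+ _ in uC uCn.
have C'C : C' <= C.
  rewrite /C' nc /C exprMn exprVn.
  have ME : M ^+ 2 = (m.+1 ^ 2)%:R * (s ^- 2 * M ^+ 2).
    by rewrite natrX mulrA mulfV ?mul1r// expf_neq0// gt_eqF.
  rewrite [in leRHS]ME expRM_natl.
  have q0 : 0 <= s ^- 2 * M ^+ 2 by rewrite mulr_ge0 ?invr_ge0 ?sqr_ge0.
  by rewrite lerXn2r ?nnegrE ?expR_ge0 ?addr_ge0 ?expR_ge1Dx.
pose g := h + h ** u.
have le_C x y : x <= C' * y -> 0 <= y -> x <= C * y.
  by move=> xy y0; rewrite (le_trans xy)// ler_wpM2r.
(* h commutes with u, hence h g = (h + h u) h, to which the telescoped bound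
   applies after rescaling h to c. *)
have hg : nrm (h ** g) <= (C + 1) * M / s.
  have hE : h = (- 'i * s%:C) *: c.
    rewrite /c scalerA mulrACA mulNr -expr2 sqrCi opprK mul1r -rmorphM.
    by rewrite mulfV ?gt_eqF// scale1r.
  have ch : c ** h = h ** c by rewrite /c bmulZl linearZ.
  have -> : h ** g = (- 'i * s%:C) *: ((h + h ** u) ** c).
    rewrite {1}hE bmulZl; congr (_ *: _).
    by rewrite /g linearD bmulDl /= bmulA ch -!bmulA uc.
  rewrite mulrC -scalerA (nrmZr _ (ltW s0)) nrmZ normrN normCi mul1r.
  rewrite [leRHS]mulrC ler_pdivlMl// mulrA -expr2.
  rewrite (le_trans (ler_wpM2l _ (uCn h))) ?sqr_ge0// mulrA.
  rewrite natrX [_ * (_ / _)]mulrC divfK ?expf_neq0 ?gt_eqF//.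
  by rewrite ler_wpM2r// lerD2r.
(* Only products of h (1 + u) by h are under control so far; the C*-identity
   reaches g = h (1 + u) itself, since g^* g = (g^* h)(1 + u), where g^* h is
   the adjoint of h g. *)
have gg : nrm g ^+ 2 <= C * ((C + 1) * M / s).
  rewrite -cstar_identity.
  have -> : star g ** g = star g ** h + (star g ** h) ** u.
    by rewrite -bmulA -linearD.
  rewrite (le_trans (le_C _ _ (uC _) (nrm_ge0 _)))// (ler_wpM2l (ltW C0))//.
  by rewrite -nrm_star starM starK hS.
(* The adjoint of (1 + u)^* g is g^* (1 + u). *)
have kg : nrm (g + star u ** g) <= C * nrm g.
  by rewrite -nrm_star starD starM starK -(nrm_star g) le_C ?uC ?nrm_ge0.
exists u; rewrite -(@ltr_pXn2r _ 2)// ?nnegrE ?nrm_ge0 ?(ltW e0)//.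
apply: (@le_lt_trans _ _ (C ^+ 2 * (C * ((C + 1) * M / s)))).
  rewrite (@le_trans _ _ ((C * nrm g) ^+ 2))//.
    by rewrite lerXn2r ?nnegrE ?nrm_ge0// mulr_ge0 ?nrm_ge0 ?(ltW C0).
  by rewrite exprMn ler_wpM2l ?sqr_ge0.
move: mP; rewrite ltr_pdivrMr ?exprn_gt0// => mP.
rewrite !mulrA ltr_pdivrMr// [ltRHS]mulrC; apply: le_lt_trans mP.
by rewrite le_eqVlt; apply/orP; left; apply/eqP; ring.
Qed.

End Cstar.

(** * Hilbert modules and their multipliers *)

Section Hilbert.
Context {R : realType} {A : cstarAlgType R} (V : hilbertModType A).
Implicit Types x y : V.

Lemma nrm_innerE x : nrm (inner x x) = nrm x ^+ 2.
Proof. by rewrite nrm_inner sqr_sqrtr ?nrm_ge0. Qed.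

HB.instance Definition _ x :=
  GRing.isLinear.Build R[i] V A *:%R (inner x) (inner_linear x).

HB.instance Definition _ x :=
  GRing.isLinear.Build R[i] A V *:%R (ract x) (ract_linearr x).

(** - x u approximates x as soon as <x, x> is compressed by 1 + u to a small
    element. *)
Lemma ract_dense x (e : R) : 0 < e ->
  exists a : A, nrm (x - x *> a) < e.
Proof.
move=> e0; have [|u uP] := selfadjoint_compress_small (inner_star x x)
  (_ : 0 < e ^+ 2); first by rewrite exprn_gt0.
exists (- u).
rewrite linearN opprK /=.
rewrite -(@ltr_pXn2r _ 2)// ?nnegrE ?nrm_ge0 ?(ltW e0)//.
apply: le_lt_trans uP; rewrite -nrm_innerE -[leRHS]nrm_star starD starM starK.
by rewrite -inner_act -linearD inner_star linearD /= inner_act.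
Qed.

(** With h = <x, x>, |x h|^2 = |h^3|, while |h|^4 = |h^4| <= |h^3| |h|; so
    |x h| is at least |x| |h|, and the supremum defining the norm of Gamma(x) is
    reached in the direction of h. *)
Lemma nrm_Gamma x : nrm (Gamma x) = nrm x.
Proof.
apply/eqP; rewrite nrm_homE eq_le op_norm_le ?nrm_ge0//; last first.
  by move=> a; exact: nrm_ract.
rewrite /=; have [->|x0] := eqVneq (nrm x) 0; first exact: op_norm_ge0.
have xp : 0 < nrm x by rewrite lt_neqAle eq_sym x0 nrm_ge0.
pose h := inner x x; have hS : star h = h := inner_star x x.
have hp : 0 < nrm h by rewrite nrm_innerE exprn_gt0.
have h3 : nrm h ^+ 4 <= nrm (h ** h ** h) * nrm h.
  have h2 : nrm (h ** h) = nrm h ^+ 2.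
    by rewrite -[X in X ** _]hS cstar_identity.
  have -> : nrm h ^+ 4 = nrm (h ** h ** h ** h).
    have hh : star (h ** h) = h ** h by rewrite starM hS.
    rewrite -bmulA.
    by rewrite -[X in X ** (_ ** _)]hh cstar_identity h2 -exprM.
  exact: nrm_bmul.
have xh : nrm (x *> h) ^+ 2 = nrm (h ** h ** h).
  rewrite -nrm_innerE inner_act -[inner _ x]inner_star inner_act starM.
  by rewrite inner_star.
have := nrm_hom (Gamma x) h; rewrite -[Gamma x h]/(x *> h).
set op := op_norm _ => xhop; have op0 : 0 <= op := op_norm_ge0 _.
rewrite -(@ler_pXn2r _ 2)// ?nnegrE ?nrm_ge0// -nrm_innerE -/h.
rewrite -(ler_pM2r (_ : 0 < nrm h ^+ 3)) ?exprn_gt0// -exprS (le_trans h3)//.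
rewrite -xh [_ ^+ 3]exprSr mulrA -exprMn ler_wpM2r ?nrm_ge0//.
by rewrite lerXn2r ?nnegrE ?mulr_ge0 ?nrm_ge0.
Qed.

Lemma Gamma_linear : linear (@Gamma R A V).
Proof. by move=> k x y; apply: hom_ext => a; exact: ract_linearl. Qed.

HB.instance Definition _ :=
  GRing.isLinear.Build R[i] V (LM V) *:%R (@Gamma R A V) Gamma_linear.

Lemma Gamma_act x a : Gamma (x *> a) = Gamma x *> left_mult a.
Proof. by apply: hom_ext => b; rewrite /= ractA. Qed.

Lemma LM_act (y : LM V) (a : A) : y *> left_mult a = Gamma (y a).
Proof. by apply: hom_ext => b; exact: homA. Qed.

Lemma nrm_LM (y : LM V) :
  nrm y = sup [set nrm (y *> left_mult a) | a in [set a : A | nrm a <= 1]].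
Proof.
rewrite nrm_homE; congr sup; apply: eq_imagel => a _.
by rewrite LM_act nrm_Gamma.
Qed.

(** The products y o left_mult(a) = Gamma(y(a)) lie in the range of Gamma, which
    is closed since V is complete; the other inclusion is the density of V A. *)
Lemma range_Gamma : range (@Gamma R A V) = closed_span
  [set z | exists (y : LM V) (a : A), z = y *> left_mult a].
Proof.
apply/seteqP; split.
  move=> _ [x _ <-] U /nbhs_ballP[e /= e0 eU].
  have er : (complex.Re e)%:C = e by rewrite RRe_real// gtr0_real.
  have r0 : 0 < complex.Re e by rewrite -ltcR er.
  have [a xa] := ract_dense x r0.
  exists (Gamma (x *> a)); split.
    exists 1%N, (fun=> 1), (fun=> Gamma (x *> a)); split.
      by move=> _; exists (Gamma x), a; rewrite Gamma_act.
    by rewrite big_ord1 scale1r.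
  apply: eU; rewrite -ball_normE/= -er ltr_nrm.
  by rewrite -linearB nrm_Gamma.
apply: subset_trans (closure_range_isometry Gamma_linear nrm_Gamma).
apply: closureS => _ [n [c [v [vS ->]]]].
elim/big_ind: _ => [|y z [x _ <-] [x' _ <-]|i _].
- by exists 0; rewrite ?linear0.
- by exists (x + x'); rewrite ?linearD.
- have [y [a ->]] := vS i; exists (c i *: y a) => //.
  by rewrite LM_act linearZ.
Qed.

End Hilbert.

(** The conditions on the pair (A, LM(A)) are those on (V, LM(V)) for V = A. *)
Lemma LM_strictly_essential (R : realType) (A : cstarAlgType R)
    (V : hilbertModType A) : is_strictly_essential (LM_extension V).
Proof.
split; last exact: nrm_LM.
  split.
  - split.
    + exact: (@Gamma_linear R A (regular_module A)).
    + exact: (@Gamma_act R A (regular_module A)).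
    + exact: (@nrm_Gamma R A (regular_module A)).
    + move=> b a; exists (b a) => //; symmetry.
      exact: (@LM_act R A (regular_module A)).
  - by split; [exact: Gamma_linear|exact: Gamma_act].
  - exact: nrm_Gamma.
  - exact: range_Gamma.
exact: (@nrm_LM R A (regular_module A)).
Qed.

(** * Maximality *)

(** Lambda(y)(a) is the preimage of y a under Phi.  The case V = A, W = B,
    Phi = iota represents B itself by left multipliers of A. *)
Lemma multiplier_representation (R : realType) (A B : banachAlgType R)
    (iota : A -> B) (V : banachModType A) (W : banachModType B) (Phi : V -> W) :
  linear iota -> {morph iota : a b / a ** b} ->
  (forall a, nrm (iota a) = nrm a) ->
  linear Phi -> (forall x a, Phi (x *> a) = Phi x *> iota a) ->
  (forall x, nrm (Phi x) = nrm x) ->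
  (forall y a, range Phi (y *> iota a)) ->
  exists Lambda : W -> LM V,
    [/\ linear Lambda, forall y a, Phi (Lambda y a) = y *> iota a &
        forall y, nrm (Lambda y) =
          sup [set nrm (y *> iota a) | a in [set a : A | nrm a <= 1]]].
Proof.
move=> il iM ii Pl PA Pi WP.
have Pinj := linear_isometry_inj Pl Pi.
have /choice[L LE] : forall p : W * A, exists x, Phi x = p.1 *> iota p.2.
  by move=> [y a]; have [x _ xE] := WP y a; exists x.
have LP y : is_bounded_module_map (fun a : regular_module A => L (y, a)).
  split=> [k a b|a b|]; first by apply: Pinj; rewrite Pl !LE /= il ract_linearr.
    by apply: Pinj; rewrite PA !LE /= iM ractA.
  by exists (nrm y) => a; rewrite -Pi LE -(ii a) nrm_ract.
exists (fun y => mk_hom (LP y)); split=> [k y z|y a|y].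
- by apply: hom_ext => a; apply: Pinj; rewrite /= Pl !LE ract_linearl.
- by rewrite /= LE.
- by rewrite nrm_homE; congr sup; apply: eq_imagel => a _; rewrite -Pi LE.
Qed.

Theorem theorem3p9 (R : realType) (A : cstarAlgType R) (V : hilbertModType A) :
  is_maximal_extension (LM_extension V).
Proof.
split; first exact: LM_strictly_essential.
case=> B iota W Phi [/= [[il iM ii iI] [Pl PA] Pi PR] Bn Wn].
rewrite /= in il iM ii iI Pl PA Pi PR Bn Wn.
have [lambda [ll lE ln]] := @multiplier_representation R A B iota
  (regular_module A) (regular_module B) iota il iM ii il iM ii iI.
have lambdaE (b : B) (a : A) : iota (lambda b a) = b ** iota a := lE b a.
have WP y a : range Phi (y *> iota a).
  rewrite PR; apply: subset_closure; exists 1%N, (fun=> 1), (fun=> y *> iota a).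
  by split; [move=> _; exists y, a|rewrite big_ord1 scale1r].
have [Lambda [Ll LE Ln]] := multiplier_representation il iM ii Pl PA Pi WP.
have iinj := linear_isometry_inj il ii.
have Pinj := linear_isometry_inj Pl Pi.
exists lambda, Lambda; split=> [|//|y|y b|x].
- split=> [//|b c|b|a].
  + apply: hom_ext => a; apply: iinj.
    rewrite -[RHS]/(iota (lambda b (lambda c a))).
    by rewrite -[LHS]/(iota (lambda (b ** c : B) a)) !lambdaE bmulA.
  + by rewrite ln -Bn.
  + apply: hom_ext => b; apply: iinj.
    exact: (etrans (lambdaE (iota a) b) (esym (iM a b))).
- by rewrite Ln -Wn.
- apply: hom_ext => a; apply: Pinj.
  rewrite -[RHS]/(Phi (Lambda y (lambda b a))).
  by rewrite -[LHS]/(Phi (Lambda (y *> b : W) a)) !LE lambdaE ractA.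
- apply: hom_ext => a; apply: Pinj.
  exact: (etrans (LE (Phi x) a) (esym (PA x a))).
Qed.
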